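(* Let $A,B,C$ be real constants with $A\neq0$, $B\neq 0$, and let $w$ be a real number satisfying $w e^{w}=-\frac{BCe^{1/A}}{A}$ (a real value of the Lambert $W$ function at $-\frac{BCe^{1/A}}{A}$) with $w\neq -1$. Put $a=\frac{1}{B}e^{\,w-\frac1A}$ and $f(y)=(Ay\ln(By)+y+C)e^y$ for $By>0$. Then $f(a)=0$, and the translated logarithmic Lambert function $W_{\mathcal{LT}}$, taken as the local inverse of $f$ near $y=a$ (so that $W_{\mathcal{LT}}(0)=a$), has Taylor series about $x=0$ beginning $$W_{\mathcal{LT}}(x)=\frac{1}{B}e^{W\left(\frac{-BCe^{1/A}}{A}\right)-\frac{1}{A}}+\frac{e^{-\frac{1}{B}e^{W\left(\frac{-BCe^{1/A}}{A}\right)-\frac{1}{A}}}}{A\left[W\left(\frac{-BCe^{1/A}}{A}\right)+1\right]}\,x+\cdots,$$ where $W\!\left(\frac{-BCe^{1/A}}{A}\right)$ stands for $w$; that is, $W_{\mathcal{LT}}(x)=a+\dfrac{e^{-a}}{A(w+1)}\,x+O(x^2)$ as $x\to0$.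
   Context: For real constants $A,B,C$, the translated logarithmic Lambert function $W_{\mathcal{LT}}(x)$ is defined as a solution $y$ (with $By>0$) of $(Ay\ln(By)+y+C)e^y=x$. The Lambert $W$ function is the (multivalued) inverse of $t\mapsto te^t$. *)

(* Defs.v *)
From Stdlib Require Import Reals Factorial.
From Coquelicot Require Import Coquelicot.

Open Scope R_scope.

(* Stdlib's [ln] is total, with junk value 0 on the nonpositive reals;
   only the values with [0 < B * y] are meaningful here. *)
Definition tll_fun (A B C y : R) : R :=
  (A * y * ln (B * y) + y + C) * exp y.

Definition tll_dom (B y : R) : Prop := 0 < B * y.

(* [g] is a local inverse at [a] of the function [f] with domain [D]: for some
   open [U] around [a] inside [D] and some open [V] around [f a], [f] and [g]
   restrict to mutually inverse bijections between [U] and [V]. The values of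
   [g] outside [V] are unconstrained. *)
Definition local_inverse (D : R -> Prop) (f : R -> R) (a : R) (g : R -> R)
  : Prop :=
  exists U V : R -> Prop,
    open U /\ open V /\ U a /\ V (f a) /\
    (forall y, U y -> D y) /\
    (forall y, U y -> V (f y) /\ g (f y) = y) /\
    (forall x, V x -> U (g x) /\ f (g x) = x).

(* The branch through [a] of the translated logarithmic Lambert function:
   near [tll_fun A B C a], [g x] is a solution [y], with [0 < B * y], of
   [(A * y * ln (B * y) + y + C) * exp y = x]. *)
Definition is_WLT_branch (A B C a : R) (g : R -> R) : Prop :=
  local_inverse (tll_dom B) (tll_fun A B C) a g.

Definition smooth_near (g : R -> R) (x0 : R) : Prop :=
  locally x0 (fun x => forall n : nat, ex_derive_n g n x).

(* [Derive_n] is total; meaningful only where [g] is differentiable enough. *)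
Definition taylor_coef (g : R -> R) (x0 : R) (n : nat) : R :=
  Derive_n g n x0 / INR (fact n).

(* Main.v *)
Require Import Defs.
From Stdlib Require Import Reals Ranalysis5 Lra ClassicalEpsilon.
From Coquelicot Require Import Coquelicot.

Open Scope R_scope.

(** The equation for [w] says exactly that [f a = 0], and it gives
    [f' a = A * (w + 1) * exp a], which is nonzero because [w <> -1]. Near a
    point where its derivative does not vanish, [f] is open (by the
    intermediate value theorem) and injective (by the mean value theorem), so a
    local inverse exists. Any local inverse [g] is then continuous and satisfies
    [g' = / (f' o g)]; since [f] is smooth, this equation bootstraps to the
    smoothness of [g], and the quadratic error bound follows from the mean value
    theorem applied to [g x - g' 0 * x]. *)

(** * Iterated differentiability on a set *)

(** Derivatives are given as witnesses constrained only on [U], rather than through the total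
    [Derive_n]. Closure under the usual operations then follows by induction from the first-order
    rules, with no formula for higher derivatives. *)
Fixpoint diff_on (n : nat) (U : R -> Prop) (f : R -> R) : Prop :=
  match n with
  | O => True
  | S m => exists f' : R -> R,
      (forall x, U x -> is_derive f x (f' x)) /\ diff_on m U f'
  end.

Lemma diff_on_pred (n : nat) (U : R -> Prop) (f : R -> R) :
  diff_on (S n) U f -> diff_on n U f.
Proof.
  revert f; induction n as [|n IH]; intros f [f' [Hf Hf']]; [exact I|].
  exists f'; split; [exact Hf | exact (IH f' Hf')].
Qed.

Lemma diff_on_const (n : nat) (U : R -> Prop) (c : R) :
  diff_on n U (fun _ => c).
Proof.
  revert c; induction n as [|n IH]; intros c; [exact I|].
  exists (fun _ => 0); split; [|apply IH].
  intros x _; apply (is_derive_const c x).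
Qed.

Lemma diff_on_id (n : nat) (U : R -> Prop) : diff_on n U (fun x => x).
Proof.
  destruct n as [|n]; [exact I|].
  exists (fun _ => 1); split; [|apply diff_on_const].
  intros x _; apply (is_derive_id x).
Qed.

Lemma diff_on_exp (n : nat) (U : R -> Prop) : diff_on n U exp.
Proof.
  induction n as [|n IH]; [exact I|].
  exists exp; split; [intros x _; apply is_derive_exp | exact IH].
Qed.

Lemma diff_on_plus (n : nat) (U : R -> Prop) (f g : R -> R) :
  diff_on n U f -> diff_on n U g -> diff_on n U (fun x => f x + g x).
Proof.
  revert f g; induction n as [|n IH]; intros f g; [intros; exact I|].
  intros [f' [Hf Hf']] [g' [Hg Hg']].
  exists (fun x => f' x + g' x); split; [|now apply IH].
  intros x Hx; apply (is_derive_plus f g x); auto.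
Qed.

(** The product rule keeps [f] and [g] themselves beside [f'] and [g'], so the induction uses them
    with one derivative fewer, by [diff_on_pred]. *)
Lemma diff_on_mult (n : nat) (U : R -> Prop) (f g : R -> R) :
  diff_on n U f -> diff_on n U g -> diff_on n U (fun x => f x * g x).
Proof.
  revert f g; induction n as [|n IH]; intros f g Df Dg; [exact I|].
  assert (Df0 := diff_on_pred _ _ _ Df); assert (Dg0 := diff_on_pred _ _ _ Dg).
  destruct Df as [f' [Hf Hf']]; destruct Dg as [g' [Hg Hg']].
  exists (fun x => f' x * g x + f x * g' x); split.
  - intros x Hx; apply (is_derive_mult f g x); auto.
    intros; apply Rmult_comm.
  - apply diff_on_plus; now apply IH.
Qed.

Lemma diff_on_inv (n : nat) (U : R -> Prop) (f : R -> R) :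
  (forall x, U x -> f x <> 0) -> diff_on n U f -> diff_on n U (fun x => / f x).
Proof.
  intros Hnz; induction n as [|n IH]; intros Df; [exact I|].
  assert (Df0 := IH (diff_on_pred _ _ _ Df)).
  destruct Df as [f' [Hf Hf']].
  (* Written with factors [/ f x], the derivative falls under the product rule and the induction
     hypothesis. *)
  exists (fun x => -1 * f' x * (/ f x * / f x)); split.
  - intros x Hx.
    replace (-1 * f' x * (/ f x * / f x)) with (- f' x / f x ^ 2)
      by (field; auto).
    apply is_derive_inv; auto.
  - apply diff_on_mult; apply diff_on_mult; auto using diff_on_const.
Qed.

Lemma diff_on_comp (n : nat) (U V : R -> Prop) (f g : R -> R) :
  (forall x, V x -> U (g x)) ->
  diff_on n U f -> diff_on n V g -> diff_on n V (fun x => f (g x)).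
Proof.
  intros HVU; revert f; induction n as [|n IH]; intros f Df Dg; [exact I|].
  assert (Dg0 := diff_on_pred _ _ _ Dg).
  destruct Df as [f' [Hf Hf']]; destruct Dg as [g' [Hg Hg']].
  exists (fun x => g' x * f' (g x)); split.
  - intros x Hx; apply (is_derive_comp f g x); auto.
  - apply diff_on_mult; auto.
Qed.

Lemma diff_on_subset (n : nat) (U V : R -> Prop) (f : R -> R) :
  (forall x, V x -> U x) -> diff_on n U f -> diff_on n V f.
Proof.
  intros HVU Df; apply (diff_on_comp n U V f (fun x => x));
    auto using diff_on_id.
Qed.

(** As [U] is open, the witness [f'] agrees with [Derive f] in a neighbourhood of each point of [U],
    so iterated differentiability passes from one to the other. *)
Lemma diff_on_ex_derive_n (n : nat) (U : R -> Prop) (f : R -> R) :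
  open U -> diff_on n U f -> forall x, U x -> ex_derive_n f n x.
Proof.
  intros HU; revert f; induction n as [|n IH]; intros f; [intros; exact I|].
  intros [f' [Hf Hf']] x Hx.
  destruct n as [|n]; [exists (f' x); auto|].
  assert (H : ex_derive_n (Derive f) (S n) x).
  { apply (ex_derive_n_ext_loc f'); [|now apply IH].
    apply (filter_imp U); [|now apply HU].
    intros y Hy; symmetry; apply is_derive_unique; auto. }
  (* The goal is differentiability of [Derive_n f (S n)], which equals [Derive_n (Derive f) n]: the
     first derivative is moved from the outside to the inside. *)
  apply (ex_derive_ext (Derive_n (Derive f) n)); [|exact H].
  intros t; rewrite (Derive_n_comp f n 1).
  now rewrite Nat.add_1_r.
Qed.

(** * Local inverses of differentiable functions *)

(** Turns the filter and norm formulation of the derivative into an inequality between absolute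
    values; the next lemma is the converse. *)
Lemma is_derive_approx (f : R -> R) (y l : R) (eps : posreal) :
  is_derive f y l ->
  locally y (fun z => Rabs (f z - f y - l * (z - y)) <= eps * Rabs (z - y)).
Proof.
  intros [_ H].
  generalize (H y (fun P HP => HP) eps); apply filter_imp; intros z Hz.
  unfold norm, minus, plus, opp, scal in Hz; simpl in Hz.
  unfold abs, mult in Hz; simpl in Hz.
  replace (f z - f y - l * (z - y))
    with (f z + - f y + - ((z + - y) * l)) by ring.
  exact Hz.
Qed.

Lemma approx_is_derive (f : R -> R) (y l : R) :
  (forall eps : posreal, locally y
     (fun z => Rabs (f z - f y - l * (z - y)) <= eps * Rabs (z - y))) ->
  is_derive f y l.
Proof.
  intros H; split; [apply is_linear_scal_l|].
  (* The definition quantifies over every limit [x] of the filter [locally y]; uniqueness of limits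
     leaves only [y]. *)
  intros x Hx; rewrite <- (is_filter_lim_locally_unique _ _ Hx).
  intros eps; generalize (H eps); apply filter_imp; intros z Hz.
  unfold norm, minus, plus, opp, scal; simpl.
  unfold abs, mult; simpl.
  replace (f z + - f y + - ((z + - y) * l))
    with (f z - f y - l * (z - y)) by ring.
  exact Hz.
Qed.

(* Linearisation puts [f (y - h)] and [f (y + h)] on opposite sides of [f y],
   so the intermediate value theorem applies without any monotonicity. *)
Lemma locally_image (f : R -> R) (y l : R) (P : R -> Prop) :
  l <> 0 -> is_derive f y l -> locally y (fun z => continuous f z) ->
  locally y P -> locally (f y) (fun x => exists z, P z /\ f z = x).
Proof.
  intros Hl Hd Hc HP.
  assert (Hl2 : 0 < Rabs l / 2) by (generalize (Rabs_pos_lt l Hl); lra).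
  assert (Ha := is_derive_approx f y l (mkposreal _ Hl2) Hd); simpl in Ha.
  destruct (filter_and _ _ (filter_and _ _ Ha Hc) HP) as [e He].
  (* Halving the radius keeps the closed interval [[y - h, y + h]] inside the open ball. *)
  set (h := e / 2).
  assert (Hh : 0 < h) by (unfold h; generalize (cond_pos e); lra).
  assert (Hball : forall z, y - h <= z <= y + h -> ball y e z).
  { intros z Hz; change (Rabs (z - y) < e); unfold h in Hz.
    apply Rabs_def1; generalize (cond_pos e); lra. }
  assert (Hd2 : 0 < Rabs l / 2 * h) by now apply Rmult_lt_0_compat.
  exists (mkposreal _ Hd2); intros x Hx.
  change (Rabs (x - f y) < Rabs l / 2 * h) in Hx.
  assert (Hscale : forall u b, Rabs u <= Rabs l * b -> Rabs (u / l) <= b).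
  { intros u b Hu; unfold Rdiv; rewrite Rabs_mult, Rabs_inv.
    apply (Rmult_le_reg_l (Rabs l)); [now apply Rabs_pos_lt|].
    replace (Rabs l * (Rabs u * / Rabs l)) with (Rabs u); [exact Hu|].
    field; now apply Rabs_no_R0. }
  assert (Hscale' : Rabs ((x - f y) / l) < h / 2).
  { unfold Rdiv; rewrite Rabs_mult, Rabs_inv.
    apply (Rmult_lt_reg_l (Rabs l)); [now apply Rabs_pos_lt|].
    replace (Rabs l * (Rabs (x - f y) * / Rabs l)) with (Rabs (x - f y));
      [lra|].
    field; now apply Rabs_no_R0. }
  apply Rabs_def2 in Hscale'.
  (* After division by [l], the increments of [f] at [y - h] and [y + h] lie within [h / 2] of [- h]
     and [h], while [x - f y] scales to less than [h / 2] in absolute value. So [(f z - x) / l] is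
     negative at the left end and positive at the right end, whatever the sign of [l]. *)
  assert (Hend : forall z, y - h <= z <= y + h ->
            Rabs ((f z - f y) / l - (z - y)) <= / 2 * Rabs (z - y)).
  { intros z Hz.
    replace ((f z - f y) / l - (z - y)) with ((f z - f y - l * (z - y)) / l)
      by (field; exact Hl).
    apply Hscale; destruct (He z (Hball z Hz)) as [[H _] _]; lra. }
  assert (Hsplit : forall z,
            (f z - x) / l = (f z - f y) / l - (x - f y) / l)
    by (intros; field; exact Hl).
  destruct (IVT_interv (fun z => (f z - x) / l) (y - h) (y + h)) as [z [Hz Hfz]].
  - intros z Hz; apply continuity_pt_filterlim.
    apply (continuous_mult (fun z => f z - x) (fun _ => / l));
      [|apply continuous_const].
    apply (continuous_minus f (fun _ => x)); [|apply continuous_const].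
    apply (He z (Hball z Hz)).
  - lra.
  - generalize (Hend (y - h)); rewrite Hsplit.
    replace (y - h - y) with (- h) by ring.
    rewrite (Rabs_Ropp h), (Rabs_pos_eq h) by lra.
    intros H; specialize (H ltac:(lra)); apply Rabs_le_between in H; lra.
  - generalize (Hend (y + h)); rewrite Hsplit.
    replace (y + h - y) with h by ring.
    rewrite (Rabs_pos_eq h) by lra.
    intros H; specialize (H ltac:(lra)); apply Rabs_le_between in H; lra.
  - exists z; split; [apply (He z (Hball z Hz))|].
    assert (f z - x = 0); [|lra].
    replace (f z - x) with ((f z - x) / l * l) by (field; exact Hl).
    rewrite Hfz; ring.
Qed.

Lemma open_ball_R (a e : R) : open (ball a e).
Proof.
  apply (open_ext (fun y => a - e < y /\ y < a + e)).
  - intros y; change (a - e < y /\ y < a + e <-> Rabs (y - a) < e); split.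
    + intros H; apply Rabs_def1; lra.
    + intros H; apply Rabs_def2 in H; lra.
  - apply open_and; [apply open_gt | apply open_lt].
Qed.

Lemma local_inverse_exists (D : R -> Prop) (f f' : R -> R) (a : R) :
  open D -> D a -> (forall y, D y -> is_derive f y (f' y)) ->
  continuous f' a -> f' a <> 0 -> exists g, local_inverse D f a g.
Proof.
  intros HD Ha Hf Hc Hnz.
  assert (Hloc : locally a (fun y => D y /\ f' y <> 0)).
  { apply filter_and; [now apply HD|].
    apply (Hc (fun v => v <> 0)), open_neq, Hnz. }
  destruct Hloc as [e He].
  assert (Hinj : forall y z, ball a e y -> ball a e z -> f y = f z -> y = z).
  { intros y z Hy Hz Hyz.
    assert (Hbetween : forall t, Rmin y z <= t <= Rmax y z -> ball a e t).
    { intros t; change (Rabs (y - a) < e) in Hy; change (Rabs (z - a) < e) in Hz.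
      change (Rmin y z <= t <= Rmax y z -> Rabs (t - a) < e).
      apply Rabs_def2 in Hy; apply Rabs_def2 in Hz.
      unfold Rmin, Rmax; destruct (Rle_dec y z); intros; apply Rabs_def1; lra. }
    destruct (MVT_gen f y z f') as [c [Hc1 Hc2]].
    - intros t Ht; apply Hf, He, Hbetween; lra.
    - intros t Ht; apply continuity_pt_filterlim, (ex_derive_continuous f).
      exists (f' t); apply Hf, He, Hbetween, Ht.
    - rewrite Hyz, Rminus_diag in Hc2.
      destruct (Rmult_integral _ _ (eq_sym Hc2)) as [H|H]; [|lra].
      now destruct (He c (Hbetween c Hc1)). }
  (* The inverse selects a preimage in the ball, unique by [Hinj]. The set [V] is the image of the
     ball, which is open by [locally_image] applied at each of its points. *)
  exists (fun x => epsilon (inhabits a) (fun y => ball a e y /\ f y = x)).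
  exists (ball a e), (fun x => exists y, ball a e y /\ f y = x).
  assert (HU : open (ball a e)) by apply open_ball_R.
  repeat split.
  - exact HU.
  - intros x [y [Hy <-]].
    apply (locally_image f y (f' y)); [apply He, Hy | apply Hf, He, Hy | |].
    + apply (filter_imp (ball a e)); [|now apply HU].
      intros z Hz; apply (ex_derive_continuous f).
      exists (f' z); apply Hf, He, Hz.
    + now apply HU.
  - apply ball_center.
  - exists a; split; [apply ball_center | reflexivity].
  - intros y Hy; apply He, Hy.
  - now exists y.
  - match goal with |- epsilon ?i ?P = _ => assert (H' := epsilon_spec i P) end.
    destruct H' as [H1 H2]; [now exists y|].
    now apply Hinj.
  - now apply (epsilon_spec (inhabits a) (fun y => ball a e y /\ f y = x)).
  - now apply (epsilon_spec (inhabits a) (fun y => ball a e y /\ f y = x)).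
Qed.

(** * Continuity and differentiability of a given local inverse *)

Section InverseRegularity.

Variables (U V : R -> Prop) (f f' g : R -> R).
Hypothesis HU : open U.
Hypothesis HV : open V.
Hypothesis Hf : forall y, U y -> is_derive f y (f' y).
Hypothesis gK : forall y, U y -> g (f y) = y.
Hypothesis fK : forall x, V x -> U (g x) /\ f (g x) = x.

(** For a neighbourhood [P] of [g x], the image under [f] of the points of [P] in [U] is a
    neighbourhood of [x], and [g] carries it back into [P]. *)
Lemma inverse_continuous (x : R) : V x -> f' (g x) <> 0 -> continuous g x.
Proof.
  intros Hx Hnz P HP; destruct (fK x Hx) as [Hgx Hfg].
  assert (H : locally (f (g x)) (fun t => exists z, (P z /\ U z) /\ f z = t)).
  { apply (locally_image f (g x) (f' (g x))); auto.
    - apply (filter_imp U); [|now apply HU].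
      intros z Hz; apply (ex_derive_continuous f); exists (f' z); auto.
    - apply filter_and; [exact HP | now apply HU]. }
  rewrite Hfg in H; unfold filtermap; revert H; apply filter_imp.
  intros t [z [[Hz HUz] <-]]; now rewrite gK.
Qed.

Lemma inverse_is_derive (x : R) :
  V x -> f' (g x) <> 0 -> is_derive g x (/ f' (g x)).
Proof.
  intros Hx Hnz; destruct (fK x Hx) as [Hgx Hfg].
  set (l := f' (g x)) in *.
  assert (Hl : 0 < Rabs l) by now apply Rabs_pos_lt.
  apply approx_is_derive; intros eps.
  (* With [p] and [q] the increments of [g] and of its argument, the linearisation of [f] gives
     [|q - l * p| <= d * |p|]. The first bound on [d] yields [|l| / 2 * |p| <= |q|]; the second then
     makes the error at most [eps * |l| * |q|]. *)
  set (d := Rmin (Rabs l / 2) (eps * (Rabs l * Rabs l) / 2)).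
  assert (Hd : 0 < d).
  { apply Rmin_glb_lt; [lra|].
    assert (0 < eps * (Rabs l * Rabs l)); [|lra].
    apply Rmult_lt_0_compat; [apply cond_pos | now apply Rmult_lt_0_compat]. }
  assert (Hd1 : d <= Rabs l / 2) by apply Rmin_l.
  assert (Hd2 : d <= eps * (Rabs l * Rabs l) / 2) by apply Rmin_r.
  assert (Happ := is_derive_approx f (g x) l (mkposreal d Hd) (Hf _ Hgx)).
  (* Continuity of [g] pulls the estimate near [g x] back to a neighbourhood of [x]. *)
  apply (inverse_continuous x Hx Hnz) in Happ; unfold filtermap in Happ.
  simpl in Happ.
  generalize (filter_and _ _ Happ (HV x Hx)); apply filter_imp.
  intros t [Ht HVt]; rewrite (proj2 (fK t HVt)), Hfg in Ht.
  set (p := g t - g x) in *; set (q := t - x) in *.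
  assert (Hp0 := Rabs_pos p); assert (Hq0 := Rabs_pos q).
  assert (Hp : Rabs l / 2 * Rabs p <= Rabs q).
  { assert (H1 : Rabs (l * p) <= Rabs (q - l * p) + Rabs q).
    { generalize (Rabs_triang (- (q - l * p)) q); rewrite Rabs_Ropp.
      now replace (- (q - l * p) + q) with (l * p) by ring. }
    rewrite Rabs_mult in H1.
    assert (d * Rabs p <= Rabs l / 2 * Rabs p)
      by now apply Rmult_le_compat_r.
    lra. }
  apply (Rmult_le_reg_l (Rabs l) _ _ Hl).
  rewrite <- Rabs_mult.
  replace (l * (p - / l * q)) with (- (q - l * p)) by (field; exact Hnz).
  rewrite Rabs_Ropp; apply (Rle_trans _ _ _ Ht).
  apply (Rle_trans _ (eps * (Rabs l * Rabs l) / 2 * Rabs p)).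
  - now apply Rmult_le_compat_r.
  - replace (eps * (Rabs l * Rabs l) / 2 * Rabs p)
      with (eps * Rabs l * (Rabs l / 2 * Rabs p)) by field.
    replace (Rabs l * (eps * Rabs q)) with (eps * Rabs l * Rabs q) by ring.
    apply Rmult_le_compat_l; [|exact Hp].
    apply Rmult_le_pos; [apply Rlt_le, cond_pos | lra].
Qed.

(** If [g] has [n] derivatives, then so does [/ f' (g x)], which is the derivative of [g]; hence [g]
    has one more. *)
Lemma inverse_diff_on (n : nat) :
  (forall y, U y -> f' y <> 0) -> (forall m, diff_on m U f') -> diff_on n V g.
Proof.
  intros Hnz Hf'; induction n as [|n IH]; [exact I|].
  exists (fun x => / f' (g x)); split.
  - intros x Hx; apply inverse_is_derive; [exact Hx | apply Hnz, fK, Hx].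
  - apply (diff_on_comp n U V (fun y => / f' y) g); [|now apply diff_on_inv|exact IH].
    intros x Hx; now apply fK.
Qed.

End InverseRegularity.

Lemma local_inverse_regular_nbhd (D : R -> Prop) (f f' g : R -> R) (a : R) :
  (forall y, D y -> is_derive f y (f' y)) -> (forall n, diff_on n D f') ->
  f' a <> 0 -> local_inverse D f a g ->
  g (f a) = a /\
  exists V, open V /\ V (f a) /\ (forall n, diff_on n V g) /\
    is_derive g (f a) (/ f' a).
Proof.
  intros Hf Hf' Hnz [U [V [HU [HV [HUa [HVa [HUD [HgU HgV]]]]]]]].
  assert (Hga : g (f a) = a) by now apply HgU.
  split; [exact Hga|].
  (* The given [U] may contain zeros of [f'], as at an inflection point. Both sets are shrunk to
     avoid them; [V'] stays open because [g] is continuous at each of its points. *)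
  set (U' := fun y => U y /\ f' y <> 0).
  set (V' := fun x => V x /\ U' (g x)).
  assert (HfU : forall y, U y -> is_derive f y (f' y)) by auto.
  assert (HgK : forall y, U y -> g (f y) = y) by (intros; now apply HgU).
  assert (HU' : open U').
  { intros y [Hy Hy']; apply filter_and; [now apply HU|].
    assert (Hc : continuous f' y).
    { destruct (Hf' 1%nat) as [f'' [H _]].
      apply (ex_derive_continuous f'); exists (f'' y); auto. }
    apply (Hc (fun v => v <> 0)), open_neq, Hy'. }
  assert (HV' : open V').
  { intros x [Hx HUx]; apply filter_and; [now apply HV|].
    apply (inverse_continuous U V f f' g HU HfU HgK HgV x Hx (proj2 HUx)).
    now apply HU'. }
  exists V'; split; [exact HV'|]; split; [|split].
  - split; [exact HVa | now rewrite Hga].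
  - intros n; apply (inverse_diff_on U' V' f f' g HU' HV').
    + intros y [Hy _]; auto.
    + intros y [Hy _]; auto.
    + intros x [Hx HUx]; split; [exact HUx | now apply HgV].
    + intros y [_ Hy]; exact Hy.
    + intros m; apply (diff_on_subset m D); [|apply Hf'].
      intros y [Hy _]; auto.
  - generalize (inverse_is_derive U V f f' g HU HV HfU HgK HgV _ HVa).
    rewrite Hga; auto.
Qed.

(** * Quadratic error of the first-order Taylor polynomial *)

Lemma taylor1_quadratic_bound (V : R -> Prop) (g : R -> R) (x0 c : R) :
  open V -> V x0 -> diff_on 2 V g -> is_derive g x0 c ->
  exists M, locally x0
    (fun x => Rabs (g x - (g x0 + c * (x - x0))) <= M * (x - x0) ^ 2).
Proof.
  intros HV Hx0 [g' [Hg [g'' [Hg' _]]]] Hc.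
  assert (Hc' : g' x0 = c).
  { now rewrite <- (is_derive_unique g x0 c Hc),
      (is_derive_unique g x0 _ (Hg x0 Hx0)). }
  set (k := g'' x0).
  destruct (filter_and _ _
    (is_derive_approx g' x0 k (mkposreal 1 Rlt_0_1) (Hg' x0 Hx0))
    (HV x0 Hx0)) as [e He]; simpl in He.
  (* Linearising [g'] at [x0] with tolerance 1 gives [|g' t - c| <= (1 + |k|) * |t - x0|]; the mean
     value theorem supplies the second factor [|x - x0|]. *)
  exists (1 + Rabs k); exists e; intros x Hx.
  change (Rabs (x - x0) < e) in Hx.
  assert (Hb : forall t, Rmin x0 x <= t <= Rmax x0 x ->
            Rabs (t - x0) <= Rabs (x - x0)).
  { intros t; unfold Rmin, Rmax; destruct (Rle_dec x0 x); intros Ht.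
    - rewrite !Rabs_pos_eq; lra.
    - rewrite !Rabs_left1; lra. }
  assert (Hball : forall t, Rmin x0 x <= t <= Rmax x0 x -> ball x0 e t).
  { intros t Ht; change (Rabs (t - x0) < e); specialize (Hb t Ht); lra. }
  assert (Hder : forall t, Rmin x0 x <= t <= Rmax x0 x ->
            is_derive (fun t => g t - c * t) t (g' t - c)).
  { intros t Ht; apply (is_derive_minus g (fun t => c * t)).
    - apply Hg, He, Hball, Ht.
    - auto_derive; [exact I | ring]. }
  destruct (MVT_gen (fun t => g t - c * t) x0 x (fun t => g' t - c))
    as [t [Ht Hmvt]].
  - intros t Ht; apply Hder; lra.
  - intros t Ht; apply continuity_pt_filterlim.
    apply (ex_derive_continuous (fun t => g t - c * t)).
    exists (g' t - c); now apply Hder.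
  - replace (g x - (g x0 + c * (x - x0)))
      with (g x - c * x - (g x0 - c * x0)) by ring.
    rewrite Hmvt, Rabs_mult, <- (pow2_abs (x - x0)).
    destruct (He t (Hball t Ht)) as [H _]; rewrite Hc' in H.
    assert (H1 : Rabs (g' t - c) <= (1 + Rabs k) * Rabs (t - x0)).
    { replace (g' t - c) with ((g' t - c - k * (t - x0)) + k * (t - x0))
        by ring.
      apply (Rle_trans _ _ _ (Rabs_triang _ _)); rewrite (Rabs_mult k); lra. }
    assert (H2 : (1 + Rabs k) * Rabs (t - x0) <= (1 + Rabs k) * Rabs (x - x0)).
    { apply Rmult_le_compat_l; [generalize (Rabs_pos k); lra | auto]. }
    replace ((1 + Rabs k) * Rabs (x - x0) ^ 2)
      with ((1 + Rabs k) * Rabs (x - x0) * Rabs (x - x0)) by ring.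
    apply Rmult_le_compat_r; [apply Rabs_pos | lra].
Qed.

(** * The translated logarithmic Lambert function *)

Lemma open_tll_dom (B : R) : open (tll_dom B).
Proof.
  apply (open_comp (fun y => B * y) (fun v => 0 < v)); [|apply open_gt].
  intros y _; apply (continuous_mult (fun _ => B) (fun y => y));
    [apply continuous_const | apply continuous_id].
Qed.

(** The last summand in the bracket is the bracket of [tll_fun] itself, so it vanishes at [a] and
    leaves [A * ln (B * a) + A + 1 = A * (w + 1)]. *)
Definition tll_deriv (A B C y : R) : R :=
  (A * ln (B * y) + (A + 1) + (A * y * ln (B * y) + y + C)) * exp y.

Lemma is_derive_tll (A B C y : R) :
  tll_dom B y -> is_derive (tll_fun A B C) y (tll_deriv A B C y).
Proof.
  intros Hy; unfold tll_fun, tll_deriv, tll_dom in *.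
  assert (B <> 0 /\ y <> 0) as [HB Hy0] by (split; intros ->; lra).
  auto_derive; [exact Hy | field; auto].
Qed.

Lemma diff_on_ln_scal (n : nat) (B : R) :
  diff_on n (tll_dom B) (fun y => ln (B * y)).
Proof.
  assert (Hnz : forall y, tll_dom B y -> B <> 0 /\ y <> 0)
    by (unfold tll_dom; intros y Hy; split; intros ->; lra).
  destruct n as [|n]; [exact I|].
  exists (fun y => / y); split.
  - intros y Hy; destruct (Hnz y Hy); unfold tll_dom in Hy.
    auto_derive; [exact Hy | field; auto].
  - apply diff_on_inv; [intros y Hy; now apply (Hnz y) | apply diff_on_id].
Qed.

Lemma diff_on_tll_deriv (n : nat) (A B C : R) :
  diff_on n (tll_dom B) (tll_deriv A B C).
Proof.
  unfold tll_deriv.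
  repeat first
    [ apply diff_on_const | apply diff_on_id | apply diff_on_exp
    | apply diff_on_ln_scal | apply diff_on_plus | apply diff_on_mult ].
Qed.

Theorem theorem3 (A B C w : R) (hA : A <> 0) (hB : B <> 0)
  (hw : w * exp w = - (B * C * exp (1 / A)) / A) (hw1 : w <> -1) :
  let a := 1 / B * exp (w - 1 / A) in
  tll_dom B a /\
  tll_fun A B C a = 0 /\
  (exists g : R -> R, is_WLT_branch A B C a g) /\
  (forall g : R -> R, is_WLT_branch A B C a g ->
     g 0 = a /\
     smooth_near g 0 /\
     taylor_coef g 0 0 = a /\
     taylor_coef g 0 1 = exp (- a) / (A * (w + 1)) /\
     (exists M : R, locally 0 (fun x : R =>
        Rabs (g x - (a + exp (- a) / (A * (w + 1)) * x)) <= M * x ^ 2))).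
Proof.
  intros a.
  assert (HBa : B * a = exp (w - 1 / A)) by (unfold a; field; exact hB).
  assert (Hln : ln (B * a) = w - 1 / A) by (rewrite HBa; apply ln_exp).
  assert (Hdom : tll_dom B a) by (unfold tll_dom; rewrite HBa; apply exp_pos).
  (* Since [A * ln (B * a) = A * w - 1], the term [a] cancels and [A * w * a + C] remains. Writing
     [a] as [exp w / (B * exp (1 / A))] brings out [w * exp w], and [hw] turns the first term into
     [- C]. *)
  assert (Hz : A * a * ln (B * a) + a + C = 0).
  { assert (Hexp : exp (1 / A) <> 0) by apply Rgt_not_eq, exp_pos.
    assert (Ha : a = exp w / (B * exp (1 / A))).
    { unfold a, Rminus; rewrite exp_plus, exp_Ropp; field; auto. }
    replace (A * a * ln (B * a) + a + C) with (A * w * a + C)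
      by (rewrite Hln; field; exact hA).
    replace (A * w * a) with (A * (w * exp w) / (B * exp (1 / A)))
      by (rewrite Ha; field; auto).
    rewrite hw; field; auto. }
  assert (Hf0 : tll_fun A B C a = 0) by (unfold tll_fun; rewrite Hz; ring).
  assert (Hf' : tll_deriv A B C a = A * (w + 1) * exp a).
  { unfold tll_deriv; rewrite Hz, Hln; field; exact hA. }
  assert (Hw : w + 1 <> 0) by lra.
  assert (Hexpa : exp a <> 0) by apply Rgt_not_eq, exp_pos.
  assert (Hnz : tll_deriv A B C a <> 0).
  { rewrite Hf'; repeat apply Rmult_integral_contrapositive_currified; auto. }
  split; [exact Hdom|]; split; [exact Hf0|]; split.
  - apply (local_inverse_exists _ _ (tll_deriv A B C)); auto.
    + apply open_tll_dom.
    + intros y; apply is_derive_tll.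
    (* Continuity of the derivative at [a] comes from its own differentiability. *)
    + destruct (diff_on_tll_deriv 1 A B C) as [f'' [H _]].
      apply (ex_derive_continuous (tll_deriv A B C)).
      exists (f'' a); auto.
  - intros g Hg.
    destruct (local_inverse_regular_nbhd _ _ (tll_deriv A B C) g a
      (is_derive_tll A B C) (fun n => diff_on_tll_deriv n A B C) Hnz Hg)
      as [Hga [V [HV [HV0 [HgV Hder]]]]].
    (* The base point [tll_fun A B C a] of the local inverse becomes 0. *)
    rewrite Hf0 in Hga, HV0, Hder.
    replace (/ tll_deriv A B C a) with (exp (- a) / (A * (w + 1))) in Hder
      by (rewrite Hf', exp_Ropp; field; auto).
    split; [exact Hga|]; split; [|split; [|split]].
    + unfold smooth_near; apply (filter_imp V); [|now apply HV].
      intros x Hx n; now apply (diff_on_ex_derive_n n V).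
    + unfold taylor_coef; simpl; rewrite Hga; field.
    + unfold taylor_coef; simpl.
      change (Derive g 0 / 1 = exp (- a) / (A * (w + 1))).
      rewrite (is_derive_unique g 0 _ Hder); field; auto.
    + destruct (taylor1_quadratic_bound V g 0 _ HV HV0 (HgV 2%nat) Hder)
        as [M HM].
      exists M; revert HM; apply filter_imp; intros x.
      now rewrite Hga, !Rminus_0_r.
Qed.
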